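(* Let $X$ be a finite-dimensional Banach space over $\mathbb{F}$ ($\mathbb{F}=\mathbb{R}$ or $\mathbb{C}$) for which the numerical radius $w(\cdot)$ is a norm on $\mathcal{L}(X)$, and let $Z$ be a subspace of $X$. Let $T\in\mathcal{L}(X)_w$ be nu-smooth. Suppose that $M_{w(T)}=\{(\mu x_0,\overline{\mu}x_0^* ) : |\mu|=1\}$ for some $x_0^*\in E_{X^*}$, $x_0\in E_X$ with $x_0^*(x_0)=1$. Assume that $x_0$ is smooth in $X$. Then $$T\perp_w\mathcal{L}(X,Z)\iff x_0\perp_B Z.$$
   Context: For a Banach space $X$ over $\mathbb{F}\in\{\mathbb{R},\mathbb{C}\}$, $X^*$ is its dual and $S_X$ its unit sphere. $E_X$ (resp. $E_{X^*}$) denotes the set of all extreme points of the closed unit ball of $X$ (resp. $X^*$). $\mathcal{L}(X)$ is the space of bounded linear operators on $X$; $\mathcal{L}(X,Z)$ is the space of bounded linear operators from $X$ into $Z$, regarded as a subspace of $\mathcal{L}(X)$. The numerical radius of $T\in\mathcal{L}(X)$ is $w(T)=\sup\{|x^*(Tx)| : x^*\in S_{X^*},\ x\in S_X,\ x^*(x)=1\}$; only spaces $X$ for which $w(\cdot)$ is a norm on $\mathcal{L}(X)$ are considered. $\mathcal{L}(X)_w$ denotes $\mathcal{L}(X)$ with the norm $w(\cdot)$, and $\mathcal{L}(X)_w^*$ is its dual. $M_{w(T)}=\{(x,x^* )\in S_X\times S_{X^*} : x^*(x)=1,\ |x^*(Tx)|=w(T)\}$. For $T\in\mathcal{L}(X)_w$,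 $J_w(T)=\{f\in\mathcal{L}(X)_w^* : \|f\|=1,\ f(T)=w(T)\}$; $T$ is nu-smooth if $J_w(T)$ is a singleton. A nonzero $x\in X$ is smooth in $X$ if $J(x)=\{f\in S_{X^*} : f(x)=\|x\|\}$ is a singleton. For $T,A\in\mathcal{L}(X)_w$, $T\perp_w A$ means $w(T+\lambda A)\geq w(T)$ for all scalars $\lambda\in\mathbb{F}$; $T\perp_w\mathcal{V}$ for a subspace $\mathcal{V}$ means $T\perp_w A$ for all $A\in\mathcal{V}$. For $x,y\in X$, $x\perp_B y$ means $\|x+\lambda y\|\geq\|x\|$ for all scalars $\lambda\in\mathbb{F}$; $x\perp_B Z$ means $x\perp_B z$ for all $z\in Z$. *)

(* Defs.v *)
From HB Require Import structures.
From mathcomp Require Import all_boot all_order all_algebra.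
From mathcomp Require Import complex.
From mathcomp Require Import all_classical all_reals all_analysis.

Set Implicit Arguments.
Unset Strict Implicit.
Unset Printing Implicit Defensive.

Import Order.TTheory GRing.Theory Num.Theory.
Import numFieldNormedType.Exports.

Local Open Scope classical_set_scope.
Local Open Scope ring_scope.

Inductive scalar_kind := RealScalars | ComplexScalars.

Definition scalars (R : realType) (k : scalar_kind) : numFieldType :=
  match k with
  | RealScalars => R : numFieldType
  | ComplexScalars => R[i]%C : numFieldType
  end.

Definition scalar_conj (R : realType) (k : scalar_kind) :
    scalars R k -> scalars R k :=
  match k return scalars R k -> scalars R k with
  | RealScalars => id
  | ComplexScalars => @conjc R
  end.

(* Over the scalar fields above, all linear maps out of a finite-dimensional
   normed space are bounded: L(X) is 'End(X), X^* is 'Hom(X, K^o), and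
   (L(X)_w)^* is 'Hom('End(X), K^o) once w is a norm. *)
#[short(type="fdBanachType")]
HB.structure Definition FDBanach (K : numFieldType) :=
  {X of Vector K X & CompleteNormedModule K X}.

Section NormNotions.
Variables (K : numFieldType) (V : vectType K).

(* Norms are K-valued, as in normedModType K. On R[i], z1 <= z2 means that
   z2 - z1 is a nonnegative real, so the supremum of a nonempty bounded set of
   real numbers is the usual one. *)
Definition is_norm (N : V -> K) : Prop :=
  [/\ forall u, 0 <= N u,
      forall u, N u = 0 -> u = 0,
      forall a u, N (a *: u) = `|a| * N u
    & forall u v, N (u + v) <= N u + N v].

Definition closed_unit_ball (N : V -> K) : set V := [set v | N v <= 1].

Definition dual_norm (N : V -> K) (f : 'Hom(V, K^o)) : K :=
  supremum 0 [set `|f v : K| | v in closed_unit_ball N].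

Definition support_functionals (N : V -> K) (v : V) : set 'Hom(V, K^o) :=
  [set f | dual_norm N f = 1 /\ f v = N v].

Definition extreme_points (B : set V) : set V :=
  [set e | B e /\ forall (u v : V) (t : K), B u -> B v -> 0 < t < 1 ->
             e = t *: u + (1 - t) *: v -> u = e /\ v = e].

Definition bj_orth (N : V -> K) (u v : V) : Prop :=
  forall a : K, N u <= N (u + a *: v).

End NormNotions.

Section NumericalRadius.
Variables (K : numFieldType) (X : fdBanachType K).
Implicit Types (x : X) (xs : 'Hom(X, K^o)) (T A : 'End(X)) (Z : {vspace X}).

Definition normX (x : X) : K := `|x|.

Definition norm_dualX (xs : 'Hom(X, K^o)) : K := dual_norm normX xs.

Definition E_X : set X := extreme_points (closed_unit_ball normX).

Definition E_dualX : set 'Hom(X, K^o) :=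
  extreme_points (closed_unit_ball norm_dualX).

Definition numerical_states : set (X * 'Hom(X, K^o)) :=
  [set p | [/\ normX p.1 = 1, norm_dualX p.2 = 1 & p.2 p.1 = 1]].

Definition numerical_radius T : K :=
  supremum 0 [set `|p.2 (T p.1) : K| | p in numerical_states].

Definition M_w T : set (X * 'Hom(X, K^o)) :=
  [set p | numerical_states p /\ `|p.2 (T p.1) : K| = numerical_radius T].

Definition nu_smooth T : Prop :=
  exists f, support_functionals numerical_radius T = [set f].

Definition smooth x : Prop :=
  x != 0 /\ exists f, support_functionals normX x = [set f].

Definition operators_into Z : set 'End(X) :=
  [set A | forall x, A x \in Z].

Definition perp_w T (VV : set 'End(X)) : Prop :=
  forall A, VV A -> bj_orth numerical_radius T A.

Definition perp_B x Z : Prop :=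
  forall z, z \in Z -> bj_orth normX x z.

End NumericalRadius.
Arguments normX {K} X.
Arguments E_X {K} X.
Arguments E_dualX {K} X.
Arguments numerical_radius {K} X.

(* Main.v *)
(* Call [f] a support functional at [u] if it has norm one and attains its norm
   at [u]. By James' theorem, [u] is orthogonal to a subspace if and only if some
   support functional at [u] vanishes on it. If [x0] is orthogonal to [Z],
   smoothness makes [x0s] this functional, so [x0s (A x0) = 0] for every [A] into
   [Z] and [w (T + a A) >= |x0s ((T + a A) x0)| = |x0s (T x0)| = w T].
   Conversely [A |-> (w T / x0s (T x0)) * x0s (A x0)] is a support functional at
   [T]; by nu-smoothness it is the one that vanishes on the operators into [Z],
   and testing it on [x |-> x0s x *: z] gives [x0s z = 0].

   James' theorem rests on Hahn-Banach, over the reals, in this form: a sublinear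
   functional lies above one that is linear along each vector of a given finite
   list, and such vectors are closed under real linear combinations. *)
Require Import Defs.
From HB Require Import structures.
From mathcomp Require Import all_boot all_order all_algebra.
From mathcomp Require Import complex.
From mathcomp Require Import all_classical all_reals all_analysis.
From mathcomp Require Import ring lra.
Import Order.TTheory GRing.Theory Num.Theory.
Import numFieldNormedType.Exports.
Local Open Scope classical_set_scope.
Local Open Scope ring_scope.

(** * Sublinear functionals over the reals and their minorants *)

Section Sublinear.
Context {R : realType} {K : fieldType} {V : lmodType K}.
Variable iota : {rmorphism R -> K}.
Implicit Types (p q : V -> R) (x y v : V) (t : R).

(** [iota] lets a [K]-space be treated as a real one. The second inequality, applied also to [t^-1],
    becomes an equality. *)
Definition sublinear p : Prop :=
  (forall x y, p (x + y) <= p x + p y) /\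
  (forall t x, 0 < t -> p (iota t *: x) <= t * p x).

Lemma iota_scaleK t x : 0 < t -> iota t^-1 *: (iota t *: x) = x.
Proof.
by move=> t0; rewrite scalerA -rmorphM mulVf ?gt_eqF// rmorph1 scale1r.
Qed.

Lemma iota_scaleVK t x : 0 < t -> iota t *: (iota t^-1 *: x) = x.
Proof.
by move=> t0; rewrite scalerA -rmorphM mulfV ?gt_eqF// rmorph1 scale1r.
Qed.

Lemma sublinearZ p : sublinear p ->
  forall t x, 0 < t -> p (iota t *: x) = t * p x.
Proof.
move=> [_ ph] t x t0; apply/eqP; rewrite eq_le ph//= -ler_pdivlMl//.
by rewrite -{1}(iota_scaleK t x t0) ph ?invr_gt0.
Qed.

Lemma sublinear0 p : sublinear p -> p 0 = 0.
Proof.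
move=> ps; have := sublinearZ p ps 2 0 (ltr0Sn _ _).
by rewrite scaler0; lra.
Qed.

Lemma sublinearN p : sublinear p -> forall x, 0 <= p x + p (- x).
Proof. by move=> ps x; rewrite -(sublinear0 p ps) -(subrr x) ps.1. Qed.

(** [C] is a convex cone of pairs on or below the graph of [p]; the minorant is the infimum of
    [p (x + c) - r] over [C]. A pair [(c, r)] in [C] forces every linear functional below [q] to be
    at least [r] at [c]. *)
Lemma sublinear_minorant p (C : V -> R -> Prop) :
  sublinear p -> C 0 0 ->
  (forall c r d s, C c r -> C d s -> C (c + d) (r + s)) ->
  (forall t c r, 0 < t -> C c r -> C (iota t *: c) (t * r)) ->
  (forall c r, C c r -> r <= p c) ->
  exists q, [/\ sublinear q, forall x, q x <= p x
              & forall c r, C c r -> q (- c) <= - r].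
Proof.
move=> ps C0 CD CZ Cp.
pose E x := [set a | exists c r, C c r /\ a = p (x + c) - r].
have Elb x : has_lbound (E x).
  (* The bound comes from [r <= p c <= p (x + c) + p (- x)]. *)
  exists (- p (- x)) => _ [c [r [Ccr ->]]].
  have := ps.1 (x + c) (- x); have := Cp _ _ Ccr.
  by rewrite addrAC subrr add0r; lra.
have E0 x : E x !=set0 by exists (p (x + 0) - 0), 0, 0.
pose q x := inf (E x).
have qle x c r : C c r -> q x <= p (x + c) - r.
  by move=> Ccr; apply: ge_inf => //; exists c, r.
have le_q x a : (forall c r, C c r -> a <= p (x + c) - r) -> a <= q x.
  by move=> h; apply: lb_le_inf => // _ [c [r [Ccr ->]]]; apply: h.
exists q; split=> [|x|c r Ccr].
- split=> [x y|t x t0].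
  + rewrite -lerBlDr; apply: (le_q) => c r Ccr.
    rewrite lerBlDr -lerBlDl; apply: le_q => d s Cds.
    have := qle (x + y) _ _ (CD _ _ _ _ Ccr Cds).
    have := ps.1 (x + c) (y + d).
    by rewrite addrACA; lra.
  + rewrite -ler_pdivrMl//; apply: le_q => c r Ccr; rewrite ler_pdivrMl//.
    apply: le_trans (qle _ _ _ (CZ _ _ _ t0 Ccr)) _.
    by rewrite -scalerDr sublinearZ// mulrBr.
- by have := qle x _ _ C0; rewrite addr0 subr0.
- by have := qle (- c) _ _ Ccr; rewrite addNr (sublinear0 p ps) sub0r.
Qed.

(** Induction on [s]: for a new [v] the cone is the ray through [(v, p' v)], which yields
    [q (- v) <= - p' v <= - q v]. Symmetry along the earlier vectors survives, since a smaller
    functional keeps [q w + q (- w) <= 0]. *)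
Lemma sublinear_symmetric_minorant p (s : seq V) : sublinear p ->
  exists q, [/\ sublinear q, forall x, q x <= p x
              & forall v, v \in s -> q (- v) = - q v].
Proof.
move=> ps; suff [q [qs qp qN]] : exists q, [/\ sublinear q,
    forall x, q x <= p x & forall v, v \in s -> q v + q (- v) <= 0].
  exists q; split=> // v vs; have := qN v vs; have := sublinearN q qs v; lra.
elim: s => [|v s [p' [p's p'p p'N]]]; first by exists p.
pose C c r := exists t, [/\ 0 <= t, c = iota t *: v & r = t * p' v].
have [q [qs qp' qC]] : exists q, [/\ sublinear q, forall x, q x <= p' x
              & forall c r, C c r -> q (- c) <= - r].
  apply: sublinear_minorant => //.
  - by exists 0; rewrite rmorph0 scale0r mul0r.
  - move=> _ _ _ _ [t [t0 -> ->]] [t' [t'0 -> ->]].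
    by exists (t + t'); rewrite rmorphD scalerDl mulrDl addr_ge0.
  - move=> a _ _ a0 [t [t0 -> ->]]; exists (a * t).
    by rewrite rmorphM scalerA mulrA mulr_ge0// ltW.
  - move=> _ _ [t [t0 -> ->]]; move: t0; rewrite le_eqVlt => /predU1P[<-|t0].
      by rewrite rmorph0 scale0r mul0r sublinear0.
    by rewrite sublinearZ.
exists q; split=> // [x|w]; first exact: le_trans (qp' x) (p'p x).
rewrite inE => /predU1P[->|/p'N]; last first.
  by have := qp' w; have := qp' (- w); lra.
have /qC : C v (p' v) by exists 1; rewrite rmorph1 scale1r mul1r.
by have := qp' v; lra.
Qed.

(** The bound [q x <= q (x + y) + q (- y)] reverses subadditivity. *)
Lemma sublinear_symmetricD q x y : sublinear q ->
  q (- x) = - q x -> q (- y) = - q y ->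
  q (x + y) = q x + q y /\ q (- (x + y)) = - q (x + y).
Proof.
move=> qs qx qy.
have := qs.1 x y; have := qs.1 (- x) (- y); have := qs.1 (x + y) (- y).
have := sublinearN q qs (x + y); rewrite -opprD addrK.
by lra.
Qed.

Lemma sublinear_symmetricZ q t x : sublinear q -> q (- x) = - q x ->
  q (iota t *: x) = t * q x /\ q (- (iota t *: x)) = - q (iota t *: x).
Proof.
move=> qs qx; have [t0|t0|->] := ltgtP t 0.
- have qneg y : q (- (iota t *: y)) = - t * q y.
    by rewrite -scaleNr -rmorphN sublinearZ// oppr_gt0.
  by rewrite qneg -[in q (iota t *: x)](opprK x) scalerN qneg qx; lra.
- by rewrite -scalerN !sublinearZ// qx mulrN.
- by rewrite rmorph0 scale0r oppr0 sublinear0// mul0r oppr0.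
Qed.

End Sublinear.

(** * Real and complex scalars handled through their real parts *)

Section Scalars.
Context {R : realType} {k : scalar_kind}.
Local Notation K := (scalars R k).

Definition of_real : {rmorphism R -> K} :=
  match k with
  | RealScalars => idfun
  | ComplexScalars => real_complex R
  end.

Definition re_part : K -> R :=
  match k with
  | RealScalars => id
  | ComplexScalars => @complex.Re R
  end.

Lemma scalar_conj1 : scalar_conj (1 : K) = 1.
Proof. by rewrite /scalar_conj; case: k => //; apply: conjc1. Qed.

Lemma re_partD : {morph re_part : a b / a + b}.
Proof. by rewrite /re_part; case: k => // -[a b] [c d]. Qed.

Lemma re_part_of_realM t a : re_part (of_real t * a) = t * re_part a.
Proof.
rewrite /re_part /of_real; case: k a => //= -[a b].
by rewrite /= mul0r subr0.
Qed.

Lemma le_re_part a b : a <= b -> re_part a <= re_part b.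
Proof.
rewrite /re_part; case: k a b => //= a b.
by rewrite lecE => /andP[].
Qed.

Lemma ge0_re_partK a : 0 <= a -> of_real (re_part a) = a.
Proof.
rewrite /re_part /of_real; case: k a => //= a a0.
by rewrite RRe_real// ger0_real.
Qed.

Lemma re_partK t : re_part (of_real t) = t.
Proof. by rewrite /re_part /of_real; case: k. Qed.

Lemma norm_of_real t : 0 <= t -> `|of_real t| = of_real t.
Proof.
rewrite /of_real; case: k => //= t0; first by rewrite ger0_norm.
by rewrite ger0_norm// ler0c.
Qed.

Lemma of_real_le s t : s <= t -> of_real s <= of_real t.
Proof. by rewrite /of_real; case: k => //=; rewrite lecR. Qed.

(** Comparing squares leaves [b ^+ 2 <= 0] for the imaginary part [b]. *)
Lemma norm_le_re_partK a : `|a| <= of_real (re_part a) -> a = of_real (re_part a).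
Proof.
rewrite /re_part /of_real; case: k a => //= -[a b].
rewrite normc_def lecR /= => h.
have a0 : 0 <= a by apply: le_trans h; rewrite sqrtr_ge0.
move: h; rewrite -[leRHS](ger0_norm a0) -sqrtr_sqr ler_sqrt ?sqr_ge0//.
rewrite gerDl => b0; have /eqP : b ^+ 2 = 0 by apply/eqP; rewrite eq_le b0 sqr_ge0.
by rewrite sqrf_eq0 => /eqP ->.
Qed.

(** With [j] equal to 0 or to the imaginary unit, a basis and its multiples by [j] span over the
    reals for both kinds of scalars. *)
Lemma real_generators : exists j : K, forall a, exists s t,
  a = of_real s + of_real t * j.
Proof.
rewrite /of_real; case: k => /=; first by exists 0 => a; exists a, 0; rewrite mulr0 addr0.
exists 'i%C => a; exists (complex.Re a), (complex.Im a).
by rewrite {1}[a]complexE mulrC [_ * 'i%C]mulrC.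
Qed.

Lemma real_part_functional (V : vectType K) (g : V -> R) :
  {morph g : x y / x + y} -> (forall t x, g (of_real t *: x) = t * g x) ->
  exists f : 'Hom(V, K^o), forall x, re_part (f x) = g x.
Proof.
rewrite /of_real /re_part; case: k V g => /= V g gD gZ.
  pose gL : {linear V -> R^o} := HB.pack g (GRing.isLinear.Build _ _ _ _ g
    (fun a x y => etrans (gD _ _) (congr1 (+%R^~ (g y)) (gZ a x)))).
  by exists (linfun gL) => x; rewrite lfunE.
(* Complex linearity forces this imaginary part: the real part of ['i%C * z] is minus the imaginary
   part of [z]. *)
pose h x : (R[i])^o := (g x +i* (- g ('i%C *: x)))%C.
have gi x : g ('i%C *: ('i%C *: x)) = - g x.
  by rewrite scalerA -expr2 sqr_i -(rmorph1 (real_complex R)) -rmorphN gZ mulN1r.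
have hL : linear h.
  move=> [a b] x y; rewrite /h.
  have -> : (a +i* b)%C = a%:C%C + b%:C%C * 'i%C :> R[i].
    by rewrite [LHS]complexE [_ * 'i%C]mulrC.
  rewrite scalerDr !scalerDl -!scalerA scalerDr.
  have -> : 'i%C *: (b%:C%C *: ('i%C *: x)) = b%:C%C *: ('i%C *: ('i%C *: x)).
    by rewrite !scalerA ['i%C * b%:C%C]mulrC.
  have -> : 'i%C *: (a%:C%C *: x) = a%:C%C *: ('i%C *: x).
    by rewrite !scalerA mulrC.
  rewrite !gD !gZ gi /GRing.scale/=; simpc.
  by apply/eqP; rewrite eq_complex /=; apply/andP; split; apply/eqP; ring.
pose hl : {linear V -> (R[i])^o} := HB.pack h (GRing.isLinear.Build _ _ _ _ h hL).
by exists (linfun hl) => x; rewrite lfunE.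
Qed.

End Scalars.

(** Complex scalars are only partially ordered, so suprema are evaluated by exhibiting a maximum. *)
Lemma supremum_maximum {d} {P : porderType d} (x0 m : P) (A : set P) :
  A m -> ubound A m -> supremum x0 A = m.
Proof.
move=> Am Aub; rewrite /supremum ifF; last by apply/negbTE/set0P; exists m.
by apply: xget_subset1; [split=> // y; apply|exact: is_subset1_supremums].
Qed.

(* A set without a least upper bound gets the default value as supremum. *)
Lemma supremum_neq_ub {d} {P : porderType d} (x0 : P) (A : set P) :
  supremum x0 A != x0 -> ubound A (supremum x0 A).
Proof.
rewrite /supremum; case: ifP => [_|_]; first by rewrite eqxx.
by case: xgetP => [y _ [] //|_]; rewrite eqxx.
Qed.

(** * Dual norms and support functionals of an abstract norm *)

Section DualNorm.
Context {K : numFieldType} {V : vectType K}.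
Implicit Types (N : V -> K) (f : 'Hom(V, K^o)) (u v : V).

Lemma is_norm0 N : is_norm N -> N 0 = 0.
Proof. by move=> [_ _ NZ _]; rewrite -(scale0r 0) NZ normr0 mul0r. Qed.

Lemma is_norm_gt0 N u : is_norm N -> u != 0 -> 0 < N u.
Proof.
by move=> [N0 Nsep _ _] /eqP u0; rewrite lt0r N0 andbT; apply/eqP => /Nsep.
Qed.

Lemma support_functional_of_le N f u : is_norm N -> u != 0 ->
  (forall v, `|f v : K| <= N v) -> f u = N u -> support_functionals N u f.
Proof.
move=> NN u0 fN fu; split=> //; have Nu := is_norm_gt0 _ _ NN u0.
have NZ : N ((N u)^-1 *: u) = 1.
  by case: NN => _ _ -> _; rewrite normfV gtr0_norm// mulVf ?gt_eqF.
rewrite /dual_norm; apply: supremum_maximum => [|_ [v v1 <-]]; last exact: le_trans (fN v) v1.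
exists ((N u)^-1 *: u); first by rewrite /closed_unit_ball /= NZ.
by rewrite linearZ /= fu /GRing.scale/= mulVf ?gt_eqF// normr1.
Qed.

Lemma le_dual_norm1 N f : is_norm N -> dual_norm N f = 1 ->
  forall v, `|f v : K| <= N v.
Proof.
move=> NN f1 v; have [->|v0] := eqVneq v 0.
  by rewrite linear0 normr0 is_norm0.
have Nv := is_norm_gt0 _ _ NN v0.
have NZ : N ((N v)^-1 *: v) = 1.
  by case: NN => _ _ -> _; rewrite normfV gtr0_norm// mulVf ?gt_eqF.
(* The value 1 differs from the default 0, so it is a genuine upper bound. *)
have : ubound [set `|f v : K| | v in closed_unit_ball N] 1.
  by rewrite -f1; apply: supremum_neq_ub; rewrite -/(dual_norm N f) f1 oner_eq0.
move=> /(_ `|f ((N v)^-1 *: v)|); rewrite linearZ /= normrM normfV.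
rewrite (gtr0_norm Nv) ler_pdivrMl// mulr1; apply.
exists ((N v)^-1 *: v); first by rewrite /closed_unit_ball /= NZ.
by rewrite linearZ /= normrM normfV (gtr0_norm Nv).
Qed.

End DualNorm.

(** * Hahn-Banach and James' theorem over both scalar fields *)

Section HahnBanach.
Context {R : realType} {k : scalar_kind}.
Local Notation K := (scalars R k).
Context {V : vectType K}.
Implicit Types (p q : V -> R) (N : V -> K) (f : 'Hom(V, K^o)) (u v w x : V).

Lemma norm_le_of_real (b : K) (t : R) :
  (forall a : K, `|a| = 1 -> re_part (a * b) <= t) -> `|b| <= of_real t.
Proof.
move=> bt; rewrite -[`|b|]ge0_re_partK//; apply: of_real_le.
have [b0|b0] := eqVneq b 0.
  by have := bt 1 (normr1 _); rewrite b0 mulr0 normr0.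
(* This unimodular factor rotates [b] onto its modulus. *)
have := bt (`|b| / b); rewrite divfK//; apply.
by rewrite normrM normfV normr_id divff// normr_eq0.
Qed.

Lemma sublinear_linear_minorant p : sublinear of_real p ->
  exists f, forall x, re_part (f x) <= p x.
Proof.
move=> ps; have [j jP] := @real_generators R k.
pose e := vbasis (@fullv K V).
(* Symmetry along [e] and its multiples by [j] spreads to their real combinations, hence to all of
   [V], and makes [q] real linear. *)
have [q [qs qp qN]] := sublinear_symmetric_minorant of_real p
  (e ++ [seq j *: v | v <- e]) ps.
have qN_all x : q (- x) = - q x.
  rewrite (coord_vbasis (memvf x)).
  apply: (big_ind (fun y => q (- y) = - q y)) => [|y z yN zN|i _].
  - by rewrite oppr0 (sublinear0 _ _ qs) oppr0.
  - exact: (sublinear_symmetricD _ _ _ _ qs yN zN).2.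
  - have [s [t ->]] := jP (coord e i x).
    have ei : e`_i \in e by rewrite mem_nth// size_tuple.
    rewrite scalerDl -scalerA.
    apply: (sublinear_symmetricD _ _ _ _ qs _ _).2;
      apply: (sublinear_symmetricZ _ _ _ _ qs _).2; apply: qN.
    + by rewrite mem_cat ei.
    + by rewrite mem_cat map_f ?orbT.
have qD : {morph q : x y / x + y}.
  by move=> x y; apply: (sublinear_symmetricD _ _ _ _ qs (qN_all x) (qN_all y)).1.
have qZ t x : q (of_real t *: x) = t * q x.
  exact: (sublinear_symmetricZ _ _ _ _ qs (qN_all x)).1.
have [f fq] := real_part_functional V q qD qZ.
by exists f => x; rewrite fq.
Qed.

Lemma sublinear_re_norm N : is_norm N -> sublinear of_real (re_part \o N).
Proof.
move=> [_ _ NZ ND]; split=> [x y|t x t0] /=.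
  by rewrite -re_partD le_re_part.
by rewrite NZ norm_of_real ?(ltW t0)// re_part_of_realM.
Qed.

(* James' characterization of Birkhoff-James orthogonality: the cone spanned by
   [u] and [W] forces the Hahn-Banach functional to be norming at [u] and to
   vanish on [W]. *)
Lemma bj_orth_support N u (W : set V) : is_norm N -> u != 0 ->
  W 0 -> (forall a x y, W x -> W y -> W (a *: x + y)) ->
  (forall w, W w -> bj_orth N u w) ->
  exists f, support_functionals N u f /\ forall w, W w -> f w = 0.
Proof.
move=> NN u0 W0 WL uW; have [N0 _ NZ ND] := NN.
have WZ a w : W w -> W (a *: w) by move=> Ww; rewrite -[_ *: _]addr0; apply: WL.
pose n := re_part \o N; have ns : sublinear of_real n := sublinear_re_norm _ NN.
have nE v : of_real (n v) = N v by rewrite /n /= ge0_re_partK.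
pose C c r := exists t w, [/\ 0 <= t, W w, c = of_real t *: u + w & r = t * n u].
have [||||q [qs qn qC]] := sublinear_minorant of_real n C ns.
- by exists 0, 0; rewrite rmorph0 scale0r addr0 mul0r.
- move=> _ _ _ _ [t [w [t0 Ww -> ->]]] [t' [w' [t'0 Ww' -> ->]]].
  exists (t + t'), (w + w'); split.
  + exact: addr_ge0.
  + by rewrite -(scale1r w); apply: WL.
  + by rewrite (rmorphD of_real) scalerDl addrACA.
  + by rewrite mulrDl.
- move=> a _ _ a0 [t [w [t0 Ww -> ->]]]; exists (a * t), (of_real a *: w); split.
  + by rewrite mulr_ge0 ?(ltW a0).
  + exact: WZ.
  + by rewrite (rmorphM of_real) scalerDr scalerA.
  + by rewrite mulrA.
(* The cone lies below [n]: for [t = 0] because [n] is nonnegative, for [t > 0] by orthogonality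
   after division by [t]. *)
- move=> _ _ [t [w [t0 Ww -> ->]]]; move: t0; rewrite le_eqVlt => /predU1P[<-|t0].
    rewrite mul0r -(re_partK (k := k) 0) (rmorph0 of_real).
    exact: le_re_part (N0 _).
  have -> : of_real t *: u + w = of_real t *: (u + of_real t^-1 *: w).
    by rewrite scalerDr (iota_scaleVK of_real).
  by rewrite (sublinearZ _ _ ns)// ler_pM2l// le_re_part// uW.
have [f fq] := sublinear_linear_minorant q qs.
have fN v : `|f v : K| <= N v.
  rewrite -nE; apply: norm_le_of_real => a a1.
  have -> : n v = n (a *: v) by rewrite /n /= NZ a1 mul1r.
  by have := le_trans (fq (a *: v)) (qn _); rewrite linearZ.
exists f; split.
  apply: support_functional_of_le => //.
  (* Evaluating at [- u] turns the upper bound by [q] into a lower bound at [u]. *)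
  have nu : n u <= re_part (f u).
    have /qC qu : C u (n u).
      by exists 1, 0; rewrite rmorph1 scale1r addr0 mul1r; split.
    have := le_trans (fq _) qu; rewrite linearN -mulN1r.
    by rewrite -(rmorph1 of_real) -rmorphN re_part_of_realM mulN1r lerN2.
  have fuE : f u = of_real (re_part (f u)) :> K.
    by apply: norm_le_re_partK; apply: le_trans (fN u) _; rewrite -nE of_real_le.
  rewrite fuE -nE; have -> // : re_part (f u) = n u.
  by apply/eqP; rewrite eq_le nu andbT; exact: le_trans (fq u) (qn u).
move=> w Ww; apply/eqP; rewrite -normr_le0 -(rmorph0 of_real).
apply: norm_le_of_real => a _.
(* The slice [t = 0] of the cone is [W] at height 0, so the real part of [f (a *: w)] is at most 0
   for every [a]. *)
have /qC : C (- (a *: w)) 0.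
  exists 0, (- (a *: w)); rewrite rmorph0 scale0r add0r mul0r; split=> //.
  by rewrite -scaleNr; apply: WZ.
by rewrite opprK oppr0; apply: le_trans; have := fq (a *: w); rewrite linearZ.
Qed.

End HahnBanach.

Lemma is_norm_normX {K : numFieldType} (X : fdBanachType K) : is_norm (normX X).
Proof.
split=> [u|u|a u|u v]; rewrite /normX //; first exact: normr0_eq0.
  exact: normrZ.
exact: ler_normD.
Qed.

(** * The numerical radius, with test operators and functionals *)

Section NumericalRadius.
Context {K : numFieldType} {X : fdBanachType K}.
Implicit Types (T A : 'End(X)) (p : X * 'Hom(X, K^o)).
Local Notation w := (numerical_radius X).

(** The default value 0 is harmless: [w A = 0] gives [A = 0] because [w] is a norm, and any other
    value is a genuine upper bound. *)
Lemma numerical_radius_ge A p : is_norm w -> numerical_states p ->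
  `|p.2 (A p.1) : K| <= w A.
Proof.
move=> [_ wsep _ _] pS; have [/wsep ->|wA] := eqVneq (w A) 0.
  rewrite zero_lfunE linear0 normr0 /numerical_radius.
  have -> // : supremum 0
      [set `|q.2 ((0 : 'End(X)) q.1) : K| | q in @numerical_states _ X] = 0.
  apply: supremum_maximum => [|_ [q _ <-]]; last by rewrite zero_lfunE linear0 normr0.
  by exists p => //; rewrite zero_lfunE linear0 normr0.
by apply: (supremum_neq_ub _ _ wA); exists p.
Qed.

Lemma rank_one_operator (f : 'Hom(X, K^o)) (z : X) :
  exists A : 'End(X), forall x, A x = (f x : K) *: z.
Proof.
pose g x : X := (f x : K) *: z.
have gL : linear g.
  by move=> a x y; rewrite /g linearP scalerDl scalerA.
pose gl : {linear X -> X} := HB.pack g (GRing.isLinear.Build _ _ _ _ g gL).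
by exists (linfun gl) => x; rewrite lfunE.
Qed.

Lemma evaluation_functional (a : K) (f : 'Hom(X, K^o)) (x : X) :
  exists h : 'Hom('End(X), K^o), forall A, h A = a * f (A x).
Proof.
pose g (A : 'End(X)) : K^o := a * f (A x).
have gL : linear g.
  move=> b A B; rewrite /g add_lfunE scale_lfunE linearP /GRing.scale/=.
  by rewrite mulrDr mulrCA.
pose gl : {linear 'End(X) -> K^o} :=
  HB.pack g (GRing.isLinear.Build _ _ _ _ g gL).
by exists (linfun gl) => A; rewrite lfunE.
Qed.

Lemma dual_normN {V : vectType K} (N : V -> K) (f : 'Hom(V, K^o)) :
  dual_norm N (- f) = dual_norm N f.
Proof.
rewrite /dual_norm; congr supremum; apply: eq_imagel => v _.
by rewrite opp_lfunE normrN.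
Qed.

(** At [T = 0] the opposite of a support functional is again one; uniqueness would make it zero,
    against norm one. *)
Lemma nu_smooth_neq0 T : is_norm w -> nu_smooth T -> T != 0.
Proof.
move=> wN [f JT]; apply/eqP => T0.
have [f1 fT] : support_functionals w T f by rewrite JT.
have : support_functionals w T (- f).
  split; first by rewrite dual_normN.
  by rewrite opp_lfunE fT T0 (is_norm0 _ wN) oppr0.
rewrite JT => /= fE.
have f0 : f = 0.
  apply/lfunP => A; have := congr1 (fun h : 'Hom(_, _) => h A) fE.
  rewrite opp_lfunE zero_lfunE => /eqP; rewrite eq_sym -addr_eq0.
  by rewrite -mulr2n -mulr_natl mulf_eq0 pnatr_eq0 => /eqP.
move: f1; rewrite f0; have -> : dual_norm w (0 : 'Hom('End(X), K^o)) = 0.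
  rewrite /dual_norm; apply: supremum_maximum => [|_ [A _ <-]].
    exists 0; first by rewrite /closed_unit_ball /= (is_norm0 _ wN).
    by rewrite zero_lfunE normr0.
  by rewrite zero_lfunE normr0.
by move/eqP; rewrite eq_sym oner_eq0.
Qed.

End NumericalRadius.

Theorem theorem3p9 (R : realType) (k : scalar_kind)
    (X : fdBanachType (scalars R k)) (Z : {vspace X})
    (T : 'End(X)) (x0 : X) (x0s : 'Hom(X, (scalars R k)^o)) :
  is_norm (numerical_radius X) ->
  nu_smooth T ->
  E_dualX X x0s -> E_X X x0 -> x0s x0 = 1 ->
  M_w T = [set (mu *: x0, scalar_conj mu *: x0s)
            | mu in [set mu : scalars R k | `|mu| = 1]] ->
  smooth x0 ->
  perp_w T (operators_into Z) <-> perp_B x0 Z.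
Proof.
move=> wN Tsmooth _ _ x0s1 MT [x0neq [g Jx0]].
have XN := is_norm_normX X.
have [x0S x0sT] : M_w T (x0, x0s).
  rewrite MT; exists 1; first by rewrite /= normr1.
  by rewrite scalar_conj1 !scale1r.
have [x01 x0sN _] := x0S.
have x0s_le := le_dual_norm1 _ _ XN x0sN.
split=> [Tperp z zZ a|x0perp A AZ a].
- have T0 := nu_smooth_neq0 T wN Tsmooth.
  have [||f [fJ fZ]] := bj_orth_support _ T (operators_into Z) wN T0 _ _ Tperp.
  + by move=> x; rewrite zero_lfunE mem0v.
  + by move=> b A B AZ BZ x; rewrite add_lfunE scale_lfunE memvD ?memvZ.
  have wT := is_norm_gt0 _ _ wN T0.
  pose c : scalars R k := x0s (T x0).
  have cN : `|c| = numerical_radius X T by exact: x0sT.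
  have c0 : c != 0 by rewrite -normr_eq0 cN gt_eqF.
  (* The factor has modulus one and rotates [c] onto [numerical_radius X T]. *)
  have [h hE] := evaluation_functional (numerical_radius X T / c) x0s x0.
  have hJ : support_functionals (numerical_radius X) T h.
    apply: support_functional_of_le => // [A|]; last by rewrite hE divfK.
    rewrite hE !normrM normfV cN (gtr0_norm wT) divff ?gt_eqF// mul1r.
    exact: (numerical_radius_ge A (x0, x0s)).
  have [A AE] := rank_one_operator x0s z.
  have x0sz : x0s z = 0.
    (* Uniqueness gives [h = f], which vanishes at [A], while [h A] is a nonzero multiple of
       [x0s z]. *)
    case: Tsmooth => g' Jg'; move: fJ hJ; rewrite Jg' => /= fg hg.
    have : h A = 0 by rewrite hg -fg fZ// => x; rewrite AE memvZ.
    rewrite hE AE x0s1 scale1r => /eqP.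
    by rewrite mulf_eq0 mulf_eq0 invr_eq0 (negbTE c0) gt_eqF//= => /eqP.
  (* The norm 1 of [x0] is the modulus of [x0s (x0 + a *: z)], and [x0s] has norm one. *)
  rewrite x01 -[leLHS]normr1 -x0s1.
  have -> : x0s x0 = x0s (x0 + a *: z) by rewrite linearD linearZ /= x0sz scaler0 addr0.
  exact: x0s_le.
- have [||f [fJ fZ]] :=
    bj_orth_support _ x0 [set z | z \in Z] XN x0neq _ _ x0perp.
  + exact: mem0v.
  + by move=> b x y xZ yZ; rewrite /= memvD ?memvZ.
  have x0sJ : support_functionals (normX X) x0 x0s by split; rewrite ?x0s1.
  have x0sE : x0s = f by move: fJ x0sJ; rewrite Jx0 => /= -> ->.
  have x0sA : x0s ((T + a *: A) x0) = x0s (T x0).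
    have x0sA0 : x0s (A x0) = 0 by rewrite x0sE fZ//=; exact: AZ.
    by rewrite add_lfunE scale_lfunE linearD linearZ /= x0sA0 scaler0 addr0.
  rewrite -x0sT /= -x0sA; exact: (numerical_radius_ge _ (x0, x0s)).
Qed.
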